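(* Let $k\ge1$, $\mathcal X\subset\mathbb R^n$ open, and $\Psi\in C^k(\mathcal X,\mathbb R)$. For arbitrary $m>n$, the map $\Psi$ can be exactly represented by an augmented scalar neural ODE $\Phi\in\mathrm{NODE}^k_{\mathrm A}(\mathcal X,\mathbb R)$ whose underlying initial value problem has dimension $m$, i.e. $\Psi(x)=\Phi(x)$ for all $x\in\mathcal X$.
   Context: Neural ODE setting. Let $T>0$ be fixed. Consider the initial value problem $\frac{\mathrm dh}{\mathrm dt}=f(t,h(t))$, $h(0)=a$, with $f:\Omega\to\mathbb R^m$, $\Omega=\Omega_t\times\Omega_h\subset\mathbb R\times\mathbb R^m$ open, with solution $h_a:\mathcal I_a\to\mathbb R^m$ on its maximal (open) interval of existence $\mathcal I_a\subset\Omega_t$. For $k\ge1$, $\mathrm{NODE}^k(\mathcal X,\mathbb R)$ is the set of all maps $\Phi:\mathcal X\to\mathbb R$, $\Phi(x)=\widetilde W\,h_{Wx+b}(T)+\tilde b$, with $W\in\mathbb R^{m\times n}$, $b\in\mathbb R^m$, $\widetilde W\in\mathbb R^{1\times m}$, $\tilde b\in\mathbb R$, with $f\in C^{0,k}(\Omega,\mathbb R^m)$ (continuous in $t$, $k$ times continuously differentiable in $h$), where $\Omega$ and $f$ may be chosen freely subject to: $\mathcal A=\{Wx+b:x\in\mathcal X\}\subset\Omega_h$ and $[0,T]\subset\mathcal I_a$ for all $a\in\mathcal A$. The neural ODE is augmented if $n<m$, $\operatorname{rank}(W)=n$ and $\operatorname{rank}(\widetilde W)=1$; $\mathrm{NODE}^k_{\mathrm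 A}(\mathcal X,\mathbb R)$ is the set of these. *)

(* Defs.v *)
From HB Require Import structures.
From mathcomp Require Import all_boot all_order all_algebra.
From mathcomp Require Import all_classical all_reals all_analysis.

Set Implicit Arguments.
Unset Strict Implicit.
Unset Printing Implicit Defensive.

Import Order.TTheory GRing.Theory Num.Theory.
Import numFieldNormedType.Exports.

Local Open Scope classical_set_scope.
Local Open Scope ring_scope.

Section Regularity.
Context {R : realType} {n : nat} {V : normedModType R}.

Let e (i : 'I_n) : 'cV[R]_n := delta_mx i ord0.

(* C^k: all iterated partial derivatives of order at most k exist and are
   continuous on U.  In the uses U is open, so these notions at a point of U
   do not depend on the values of g outside U. *)
Fixpoint Ck (k : nat) (U : set 'cV[R]_n) (g : 'cV[R]_n -> V) : Prop :=
  (forall x, U x -> {for x, continuous g}) /\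
  (if k is k'.+1 then
     forall i : 'I_n,
       (forall x, U x -> derivable g x (e i)) /\
       Ck k' U (fun x => 'D_(e i) g x)
   else True).

(* C^{0,k}: all iterated partial derivatives in h of order at most k exist and
   are jointly continuous in (t, h) on Omega. *)
Fixpoint C0k (k : nat) (Omega : set (R * 'cV[R]_n))
    (f : R -> 'cV[R]_n -> V) : Prop :=
  (forall p, Omega p -> {for p, continuous (fun q => f q.1 q.2)}) /\
  (if k is k'.+1 then
     forall i : 'I_n,
       (forall p, Omega p -> derivable (f p.1) p.2 (e i)) /\
       C0k k' Omega (fun t h => 'D_(e i) (f t) h)
   else True).

End Regularity.

Section InitialValueProblem.
Context {R : realType} {m : nat}.
Variables (Omega : set (R * 'cV[R]_m)) (f : R -> 'cV[R]_m -> 'cV[R]_m).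

(* Only the restriction of h to I matters. *)
Definition ivp_solution (a : 'cV[R]_m) (I : set R) (h : R -> 'cV[R]_m) : Prop :=
  [/\ open I, is_interval I, I 0, h 0 = a &
      forall t, I t -> Omega (t, h t) /\ is_derive t 1 h (f t (h t))].

(* h is the solution h_a and I its maximal interval of existence: every
   solution of the initial value problem is a restriction of (I, h).  This
   determines I, and h on I. *)
Definition maximal_solution (a : 'cV[R]_m) (I : set R) (h : R -> 'cV[R]_m) : Prop :=
  ivp_solution a I h /\
  forall J g, ivp_solution a J g -> J `<=` I /\ (forall t, J t -> g t = h t).

End InitialValueProblem.

Record node_data (R : realType) (n m : nat) := NodeData {
  node_Ot : set R;
  node_Oh : set 'cV[R]_m;
  node_f : R -> 'cV[R]_m -> 'cV[R]_m;
  node_W : 'M[R]_(m, n);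
  node_b : 'cV[R]_m;
  node_Wt : 'rV[R]_m;
  node_bt : R }.

Section NeuralODE.
Context {R : realType} {n m : nat}.

Definition node_Omega (N : node_data R n m) : set (R * 'cV[R]_m) :=
  node_Ot N `*` node_Oh N.

Definition node_in (N : node_data R n m) (x : 'cV[R]_n) : 'cV[R]_m :=
  node_W N *m x + node_b N.

Definition node_out (N : node_data R n m) (y : 'cV[R]_m) : R :=
  (node_Wt N *m y) ord0 ord0 + node_bt N.

(* The scalar neural ODE with data N is well defined on X and is the map Phi,
   as a map on X (values of Phi outside X are irrelevant). *)
Definition is_node (k : nat) (T : R) (X : set 'cV[R]_n) (N : node_data R n m)
    (Phi : 'cV[R]_n -> R) : Prop :=
  [/\ open (node_Ot N), open (node_Oh N),
      C0k k (node_Omega N) (node_f N),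
      (forall x, X x -> node_Oh N (node_in N x)) &
      forall x, X x -> exists (I : set R) (h : R -> 'cV[R]_m),
        [/\ maximal_solution (node_Omega N) (node_f N) (node_in N x) I h,
            `[0, T] `<=` I & Phi x = node_out N (h T)]].

Definition augmented (N : node_data R n m) : Prop :=
  [/\ (n < m)%N, \rank (node_W N) = n & \rank (node_Wt N) = 1%N].

End NeuralODE.

(* The elements of NODE^k(X, R), resp. NODE^k_A(X, R), whose underlying initial
   value problem has dimension m. *)
Definition NODE (R : realType) (n m k : nat) (T : R) (X : set 'cV[R]_n) :
    set ('cV[R]_n -> R) :=
  [set Phi | exists N : node_data R n m, is_node k T X N Phi].

Definition NODE_A (R : realType) (n m k : nat) (T : R) (X : set 'cV[R]_n) :
    set ('cV[R]_n -> R) :=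
  [set Phi | exists N : node_data R n m, is_node k T X N Phi /\ augmented N].

(* Main.v *)
(** Let [P] be the projection of R^m onto its first [n] coordinates, let [v] be
    [T^-1] times the [n]-th (0-based) unit vector, and run the autonomous
    equation [h' = Psi (P h) v] from the zero-padded input [(x, 0)].  Since
    [P v = 0], [P h] is constant, so the solution is the line
    [(x, 0) + t Psi(x) v], whose [n]-th coordinate is [Psi x] at time [T].  The
    field is as smooth as [Psi] because it only depends on [P h]. *)
Require Import Defs.
From HB Require Import structures.
From mathcomp Require Import all_boot all_order all_algebra.
From mathcomp Require Import all_classical all_reals all_analysis.
Import Order.TTheory GRing.Theory Num.Theory.
Import numFieldNormedType.Exports.
Local Open Scope classical_set_scope.
Local Open Scope ring_scope.

Lemma is_derive_scalel (R : numFieldType) (U V : normedModType R) (G : U -> R)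
    (x w : U) (d : R) (v : V) :
  is_derive x w G d -> is_derive x w (fun y => G y *: v) (d *: v).
Proof.
move=> [dG <-].
have cG : h^-1 *: (G (h *: w + x) *: v - G x *: v) @[h --> 0^']
    --> 'D_w G x *: v.
  under eq_fun do rewrite -scalerBl scalerA.
  exact: cvgZr_tmp.
by apply: DeriveDef; [apply/cvg_ex; exists ('D_w G x *: v) | exact: cvg_lim].
Qed.

(** The product is a combination of the columns of [A] whose coefficients are the coordinates of the
    vector, and coordinates are continuous. *)
Lemma continuous_mulmx (R : realFieldType) (m n : nat) (A : 'M[R]_(m, n)) :
  continuous (fun y : 'cV[R]_n => A *m y).
Proof.
move=> y.
have -> : (fun z : 'cV[R]_n => A *m z) =
    (fun z => \sum_(i < n) z i ord0 *: col i A).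
  apply/funext => z; apply/matrixP => i j; rewrite mxE summxE.
  by apply: eq_bigr => l _; rewrite !mxE (ord1 j) mulrC.
elim: (index_enum _) => [|i s IHs].
  rewrite (_ : (fun _ => _) = cst 0); first exact: cst_continuous.
  by apply/funext => z; rewrite big_nil.
rewrite (_ : (fun _ => _) = fun z : 'cV[R]_n => z i ord0 *: col i A +
  \sum_(j <- s) z j ord0 *: col j A); last first.
  by apply/funext => z; rewrite big_cons.
by apply: cvgD IHs; apply: cvgZr_tmp; exact: coord_continuous.
Qed.

Lemma is_derive_mulmx (R : realFieldType) (V : normedModType R) (m n : nat)
    (A : 'M[R]_(m, n)) (g : V -> 'cV[R]_n) (x v : V) (d : 'cV[R]_n) :
  is_derive x v g d -> is_derive x v (fun y => A *m g y) (A *m d).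
Proof.
move=> [dg <-].
have cg : h^-1 *: (A *m g (h *: v + x) - A *m g x) @[h --> 0^']
    --> A *m 'D_v g x.
  under eq_fun do rewrite -mulmxBr scalemxAr.
  by apply: continuous_cvg; [exact: continuous_mulmx|].
by apply: DeriveDef; [apply/cvg_ex; exists (A *m 'D_v g x) | exact: cvg_lim].
Qed.

(** By linearity of [A] the two difference quotients are the same function of the step, so this is
    an equality of propositions for arbitrary [G]. *)
Lemma derivable_comp_mulmx (R : realFieldType) (V : normedModType R) (m n : nat)
    (A : 'M[R]_(m, n)) (G : 'cV[R]_m -> V) (y v : 'cV[R]_n) :
  derivable (fun z => G (A *m z)) y v = derivable G (A *m y) (A *m v).
Proof.
by rewrite /derivable; under eq_fun do rewrite /= mulmxDr -scalemxAr.
Qed.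

Lemma derive_comp_mulmx (R : realFieldType) (V : normedModType R) (m n : nat)
    (A : 'M[R]_(m, n)) (G : 'cV[R]_m -> V) (y v : 'cV[R]_n) :
  'D_v (fun z => G (A *m z)) y = 'D_(A *m v) G (A *m y).
Proof.
by rewrite /derive; under eq_fun do rewrite /= mulmxDr -scalemxAr.
Qed.

Lemma Ck_cst0 (R : realType) (n : nat) (V : normedModType R) (k : nat)
    (U : set 'cV[R]_n) : Ck k U (fun _ => 0 : V).
Proof.
elim: k => [|k IHk] /=; (split=> [x _|]; first exact: cst_continuous) => // i.
split=> [x _|]; first exact: derivable_cst.
by under eq_fun do rewrite derive_cst.
Qed.

(** Consequently a partial derivative of a pullback along [pid_mx n] is either a partial derivative
    of the original function or zero. *)
Lemma pid_mx_delta (R : pzRingType) (n m : nat) (i : 'I_m) :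
  pid_mx n *m delta_mx i ord0 =
  (if insub (i : nat) is Some j then delta_mx j ord0 else 0) :> 'cV[R]_n.
Proof.
rewrite -colE; case: insubP => [j _ ji | nin]; apply/matrixP => l c.
  by rewrite !mxE -ji (ord1 c) eqxx andbT ltn_ord andbT.
rewrite !mxE ltn_ord andbT; case: eqP => // li.
by rewrite -li ltn_ord in nin.
Qed.

Lemma open_preimage_mulmx (R : realFieldType) (n m : nat) (A : 'M[R]_(n, m))
    (X : set 'cV[R]_n) : open X -> open [set y : 'cV[R]_m | X (A *m y)].
Proof. by apply: open_comp => y _; exact: continuous_mulmx. Qed.

(* The equation on F is only required on the domain, since this is all that the
   iterated derivatives of F inherit: junk values of 'D elsewhere need not
   commute with scaling by v. *)
Lemma C0k_pullback (R : realType) (n m k : nat) (V : normedModType R)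
    (X : set 'cV[R]_n) (G : 'cV[R]_n -> R) (v : V)
    (F : R -> 'cV[R]_m -> V) :
  open X -> Ck k X G ->
  (forall t y, X (pid_mx n *m y) -> F t y = G (pid_mx n *m y) *: v) ->
  C0k k (setT `*` [set y | X (pid_mx n *m y)]) F.
Proof.
move=> Xo; set P : 'M[R]_(n, m) := pid_mx n.
have XPo := open_preimage_mulmx _ _ _ P X Xo.
have cF (H : 'cV[R]_n -> R) (K : R -> 'cV[R]_m -> V) :
    (forall x, X x -> {for x, continuous H}) ->
    (forall t y, X (P *m y) -> K t y = H (P *m y) *: v) ->
    forall p : R * 'cV[R]_m, (setT `*` [set y | X (P *m y)]) p ->
    {for p, continuous (fun q => K q.1 q.2)}.
  move=> cH KE p [_ /= Xp].
  suff cHP : (H (P *m q.2) *: v) @[q --> p] --> K p.1 p.2.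
    apply: cvg_trans cHP; apply: near_eq_cvg.
    have nX : \forall q \near p, X (P *m q.2).
      have nXy : nbhs p.2 [set y | X (P *m y)] by exact: open_nbhs_nbhs.
      exact: (@cvg_snd _ _ (nbhs p.1) (nbhs p.2) _ _ nXy).
    by apply: filterS nX => q /KE ->.
  rewrite KE//; apply: cvgZr_tmp; apply: (@continuous_cvg _ _ _ _ _ _ H); first exact: cH.
  by apply: continuous_cvg; [exact: continuous_mulmx | exact: cvg_snd].
elim: k G F => [|k IHk] G F /= [cG dG] FE; (split; first exact: cF cG FE) => //.
move=> i.
pose w : 'cV[R]_n := P *m delta_mx i ord0.
(* If [i < n], then [w] is a basis vector and [G'] is a partial derivative of [G]; otherwise [w = 0]
   and [G'] vanishes identically. *)
have [G' [dG' G'E CG']] : exists G' : 'cV[R]_n -> R,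
    [/\ forall x, X x -> derivable G x w, forall x, 'D_w G x = G' x
      & Ck k X G'].
  exists (fun x => 'D_w G x); rewrite /w pid_mx_delta.
  case: insubP => [j _ _|_]; first by have [] := dG j; split.
  split=> //[x _|]; first exact: derivable0.
  by under eq_fun do rewrite derive0; exact: Ck_cst0.
have dF t y : X (P *m y) ->
    is_derive y (delta_mx i ord0) (F t) (G' (P *m y) *: v).
  (* [FE] holds on a whole neighbourhood of [y], because the preimage of [X] is open. *)
  move=> Xy; apply: (near_eq_is_derive (f := fun z => G (P *m z) *: v)).
    have : \forall z \near y, X (P *m z) by exact: open_nbhs_nbhs.
    by apply: filterS => z /FE ->.
  apply: is_derive_scalel; apply: DeriveDef.
    by rewrite derivable_comp_mulmx; exact: dG'.
  by rewrite derive_comp_mulmx G'E.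
split=> [[t y] [_ /= Xy]|]; first by have [] := dF t y Xy.
apply: (IHk G') => // t y Xy.
by have [_ ->] := dF t y Xy.
Qed.

(** The mean value theorem is applied to each entry on the segment between [s] and [t], which stays
    inside the interval [J]. *)
Lemma is_derive_cst_affine (R : realType) (m : nat) (J : set R)
    (g : R -> 'cV[R]_m) (c : 'cV[R]_m) (s t : R) :
  is_interval J -> (forall r, J r -> is_derive r 1 g c) -> J s -> J t ->
  g t = g s + (t - s) *: c.
Proof.
move=> iJ dg.
wlog st : s t / s <= t => [H Js Jt|Js Jt].
  have [/H->//|/ltW ts] := leP s t.
  by rewrite (H t s)// -addrA -scalerDl subrKA subrr scale0r addr0.
apply/matrixP => i j.
have dgij r : J r -> is_derive r 1 (fun u => g u i j) (c i j).
  move=> Jr; have [dgr gE] := dg r Jr.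
  apply: DeriveDef; first by have /derivable_mxP := dgr; exact.
  by rewrite -gE derive_mx// mxE.
have Jst r : s <= r <= t -> J r by move=> srt; exact: iJ Js Jt _ srt.
have [||r _ gE] := @MVT_segment _ (fun u => g u i j) (fun=> c i j) s t st.
- by move=> r; rewrite in_itv/= => /andP[/ltW sr /ltW rt];
    apply: dgij; apply: Jst; rewrite sr.
- apply: derivable_within_continuous => r; rewrite in_itv/= => /Jst Jr.
  by have [] := dgij r Jr.
- by rewrite !mxE mulrC -gE subrKC.
Qed.

Section StationaryParameter.
Context {R : realType} {n m : nat}.
Variables (X : set 'cV[R]_n) (G : 'cV[R]_n -> R) (P : 'M[R]_(n, m))
  (v : 'cV[R]_m).
Hypothesis Pv0 : P *m v = 0.

Let Omega : set (R * 'cV[R]_m) := setT `*` [set y | X (P *m y)].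
Let f (t : R) (y : 'cV[R]_m) := G (P *m y) *: v.

(* [P *m y] is a first integral of the field, so every solution is affine. *)
Lemma maximal_solution_stationary (a : 'cV[R]_m) : X (P *m a) ->
  maximal_solution Omega f a setT (fun t => a + t *: (G (P *m a) *: v)).
Proof.
move=> Xa.
have Pline (r : R) : P *m (a + r *: v) = P *m a.
  by rewrite mulmxDr -scalemxAr Pv0 scaler0 addr0.
split.
  split=> //; first exact: openT.
    by rewrite scale0r addr0.
  move=> t _; rewrite /Omega /f /= scalerA Pline; split=> //.
  rewrite -[X in is_derive _ _ _ X]add0r -[X in _ + X]scale1r.
  apply: (@is_deriveD _ _ _ (cst a)).
  exact: (@is_derive_scalel _ _ _ id).
move=> J g [_ iJ J0 g0 dg]; split=> // t Jt.
(* Along any competing solution [P *m g] has derivative [P *m f = 0], so it keeps its initial value;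
   the velocity of [g] is then constant and [g] is affine. *)
have Pg r : J r -> P *m g r = P *m a.
  move=> Jr; have dPg u : J u -> is_derive u 1 (fun w => P *m g w) 0.
    move=> Ju; have [_ dgu] := dg u Ju.
    by rewrite -[X in is_derive _ _ _ X](_ : P *m f u (g u) = 0);
      [exact: is_derive_mulmx | rewrite /f -scalemxAr Pv0 scaler0].
  by have := is_derive_cst_affine _ _ J _ _ 0 r iJ dPg J0 Jr;
    rewrite g0 scaler0 addr0.
have dgc r : J r -> is_derive r 1 g (G (P *m a) *: v).
  by move=> Jr; have [_] := dg r Jr; rewrite /f Pg.
by rewrite (is_derive_cst_affine _ _ J g _ 0 t iJ dgc)// g0 subr0.
Qed.

End StationaryParameter.

Theorem theorem4p20 (R : realType) (T : R) (T_gt0 : 0 < T) (k n m : nat)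
    (k_ge1 : (1 <= k)%N) (n_lt_m : (n < m)%N)
    (X : set 'cV[R]_n) (X_open : open X)
    (Psi : 'cV[R]_n -> R) (Psi_Ck : Ck k X Psi) :
  exists2 Phi : 'cV[R]_n -> R,
    NODE_A m k T X Phi & forall x, X x -> Psi x = Phi x.
Proof.
exists Psi => //.
pose P : 'M[R]_(n, m) := pid_mx n.
pose j0 := Ordinal n_lt_m.
pose v : 'cV[R]_m := T^-1 *: delta_mx j0 ord0.
have Pv0 : P *m v = 0.
  by rewrite -scalemxAr pid_mx_delta insubF ?scaler0//= ltnn.
have PW x : P *m (pid_mx n *m x + 0) = x.
  by rewrite addr0 mulmxA mul_pid_mx minnn (minn_idPr (ltnW n_lt_m))
    pid_mx_1 mul1mx.
(* The space domain is the cylinder over [X], which each solution line never leaves; the readout row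
   selects coordinate [j0]. *)
exists (@NodeData R n m setT [set y | X (P *m y)]
  (fun _ y => Psi (P *m y) *: v) (pid_mx n) 0 (delta_mx ord0 j0) 0).
split; last first.
  split=> //=; last exact: mxrank_delta.
  by rewrite rank_pid_mx// ltnW.
split=> /=.
- exact: openT.
- exact: open_preimage_mulmx.
- exact: C0k_pullback X_open Psi_Ck _.
- by move=> x Xx; rewrite /node_in/= PW.
move=> x Xx; exists setT; eexists; split=> //.
  by apply: maximal_solution_stationary => //; rewrite /node_in/= PW.
(* The padded input is zero in coordinate [j0], so only the drift [T * (Psi x * T^-1)] remains. *)
rewrite /node_out /node_in/= PW !addr0 -rowE !mxE big1 => [|i _].
  by rewrite !eqxx mulr1 add0r mulrCA mulfV ?mulr1// gt_eqF.
by rewrite !mxE ltnn andbF mul0r.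
Qed.
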